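(* Let $\tilde f:\mathbb R^n\to\mathbb R\cup\{\infty\}$ be a proper lower semicontinuous function satisfying the KL inequality with respect to $x^*$ in $B_\delta(x^* )\cap[\tilde f(x^* )<\tilde f<\eta]$ with desingularizing function $\varphi(t)=\frac M\theta t^\theta$ for some $M>0$ and $\theta\in(0,\frac12]$. Let $a,b>0$ and let $\{x_k\}_{k\ge0}$ be a sequence such that for every $k$ $$\tilde f(x_{k+1})+a\|x_{k+1}-x_k\|^2\le\tilde f(x_k),$$ and such that for every $k$ there is a point $\tilde x_k$ with $\partial\tilde f(\tilde x_k)\neq\emptyset$, $$\tilde f(x_k)-\tilde f(x_{k+1})\ge\frac a{b^2}\,\mathrm{dist}(\partial\tilde f(\tilde x_k),0)^2,\qquad \tilde f(x_{k+1})\le\tilde f(\tilde x_k)\le\tilde f(x_k)-a\|\tilde x_k-x_k\|^2 .$$ Assume that $\tilde f(x^* )\le\tilde f(x_0)<\eta$ and that, for every $k$, $x_k\in B_\delta(x^* )$ implies $\tilde f(x_{k+1})\ge\tilde f(x^* )$. Let $\alpha(t)=\frac b{\sqrt a}\varphi'(t)$ and assume also that $$\frac ba\varphi(\tilde f(x_0)-\tilde f(x^* ))+2\sqrt{\frac{\tilde f(x_0)-\tilde f(x^* )-\sigma_\alpha(\tilde f(x_0)-\tilde f(x^* ))}{a}}+\|x_0-x^*\|<\delta .$$ Then, as $k\to\infty$, $$\tilde f(x_k)-\tilde f(x^* )=\begin{cases}O\big(1/k^{\frac1{1-2\theta}}\big)&\text{if }0<\theta<\frac12,\\ O\big((1+\frac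 a{b^2M^2})^{-k}\big)&\text{if }\theta=\frac12,\end{cases}$$ $$\sum_{i=k}^\infty\|x_i-x_{i+1}\|=\begin{cases}O\big(1/k^{\frac\theta{1-2\theta}}\big)&\text{if }0<\theta<\frac12,\\ O\big((1+\frac a{b^2M^2})^{-k/2}\big)&\text{if }\theta=\frac12.\end{cases}$$ Finally, the implicit constants can be taken as functions of $M,\theta,a,b$ and $\eta-\tilde f(x^* )$, and in particular independent from $x_0$.
   Context: $B_\delta(x^* )$ is the open Euclidean ball, $[\eta_1<\tilde f<\eta_2]=\{x:\eta_1<\tilde f(x)<\eta_2\}$, and $\partial\tilde f$ is the limiting subdifferential: $z\in\hat\partial\tilde f(x)$ (Fréchet subdifferential) iff $\tilde f(y)\ge\tilde f(x)+\langle z,y-x\rangle+o(\|y-x\|)$, and $\partial\tilde f(x)$ is the set of limits of $z_n\in\hat\partial\tilde f(x_n)$ with $x_n\to x$, $\tilde f(x_n)\to\tilde f(x)$. KL inequality with respect to $x^*$ in $B_\delta(x^* )\cap[\tilde f(x^* )<\tilde f<\eta]$ with desingularizing function $\varphi$ (where $\tilde f(x^* )$ is finite and $\eta>\tilde f(x^* )$): $\varphi:[0,\eta-\tilde f(x^* ))\to\mathbb R_{\ge0}$ is continuous and concave, $\varphi(0)=0$, $\varphi$ is $C^1$ with $\varphi'>0$ on $(0,\eta-\tilde f(x^* ))$, and $\varphi'(\tilde f(x)-\tilde f(x^* ))\,\mathrm{dist}(\partial\tilde f(x),0)\ge1$ for all $x$ in that set. For $\alpha$ continuous and non-increasing on $[0,\eta-\tilde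 f(x^* ))$ with values in $\mathbb R_{>0}\cup\{\infty\}$, finite for $t>0$ (with $\alpha(0)=\lim_{t\to0^+}\alpha(t)$), one defines $\sigma_\alpha(t)=\max\{s\in[0,t]:\ 1/\alpha(s)^2\le t-s\}$, with $1/\infty=0$ and $\max(\emptyset)=0$. *)

(* Defs.v *)
From mathcomp Require Export all_boot all_order all_algebra.
From mathcomp Require Export all_classical all_reals all_analysis.
Export Order.TTheory GRing.Theory Num.Theory.
Export numFieldNormedType.Exports.

Set Implicit Arguments.
Unset Strict Implicit.
Unset Printing Implicit Defensive.

Local Open Scope classical_set_scope.
Local Open Scope ring_scope.

(* The library norm on 'rV[R]_n is the sup norm, so the Euclidean structure is
   written out; the topology of 'rV[R]_n is the same for both norms. *)
Definition edot (R : realType) (n : nat) (u v : 'rV[R]_n) : R :=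
  \sum_i u 0 i * v 0 i.

Definition enorm (R : realType) (n : nat) (u : 'rV[R]_n) : R :=
  Num.sqrt (edot u u).

Definition open_eball (R : realType) (n : nat) (x : 'rV[R]_n) (d : R) :
  set 'rV[R]_n := [set y | enorm (y - x) < d].

(* dist(A, z), equal to +oo when A is empty *)
Definition edist_set (R : realType) (n : nat) (A : set 'rV[R]_n)
    (z : 'rV[R]_n) : \bar R :=
  ereal_inf [set (enorm (y - z))%:E | y in A].

Section subdifferential.
Context (R : realType) (n : nat).
Implicit Type f : 'rV[R]_n -> \bar R.
Local Open Scope ereal_scope.

Definition proper_fun f :=
  (forall x, f x != -oo) /\ (exists x, f x < +oo).

(* f y >= f x + <z, y - x> + o(|y - x|) as y tends to x; by convention the
   subdifferential is empty outside the domain of f. *)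
Definition frechet_subdiff f (x : 'rV[R]_n) : set 'rV[R]_n :=
  [set z | f x \is a fin_num /\
    forall e : R, (0 < e)%R ->
      \forall y \near x,
        f x + (edot z (y - x) - e * enorm (y - x))%:E <= f y].

Definition limiting_subdiff f (x : 'rV[R]_n) : set 'rV[R]_n :=
  [set z | exists xs zs : nat -> 'rV[R]_n,
    [/\ forall m, frechet_subdiff f (xs m) (zs m),
        xs @ \oo --> x,
        f (xs m) @[m --> \oo] --> f x &
        zs @ \oo --> z]].

(* desingularizing function on [0, h), where h may be +oo *)
Definition desingularizing (h : \bar R) (phi : R -> R) :=
  let D := [set t : R | (0 <= t)%R /\ t%:E < h] in
  [/\ {within D, continuous phi},
      convex_function (D : set R) (fun t => - phi t)%R,
      forall t, D t -> (0 <= phi t)%R,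
      phi 0%R = 0%R &
      forall t : R, (0 < t)%R -> t%:E < h ->
        [/\ derivable phi t 1, {for t, continuous (derive1 phi)} &
            (0 < derive1 phi t)%R]].

(* KL inequality with respect to xs in B_delta(xs) /\ [f xs < f < eta] *)
Definition KL_inequality f (xs : 'rV[R]_n) (delta : R) (eta : \bar R)
    (phi : R -> R) :=
  [/\ f xs \is a fin_num,
      f xs < eta,
      desingularizing (eta - f xs) phi &
      forall x, open_eball xs delta x -> f xs < f x -> f x < eta ->
        1 <= (derive1 phi (fine (f x - f xs)))%:E
             * edist_set (limiting_subdiff f x) 0%R].

End subdifferential.

Section sigma.
Context (R : realType).

(* maximum of a set of reals, with max(set0) = 0 *)
Definition set_max (A : set R) : R := xget 0 [set s | A s /\ ubound A s].

(* The inverse of \bar R sends +oo to 0. *)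
Definition sigma (alpha : R -> \bar R) (t : R) : R :=
  set_max [set s | [/\ 0 <= s, s <= t &
                       ((alpha s ^+ 2)^-1 <= (t - s)%:E)%E]].

(* alpha = (b / sqrt a) * phi' on t > 0, extended to 0 by its right limit,
   which may be +oo *)
Definition alpha_of (a b : R) (phi : R -> R) (t : R) : \bar R :=
  if t == 0 then lim ((b / Num.sqrt a * derive1 phi s)%:E @[s --> 0^'+])
  else (b / Num.sqrt a * derive1 phi t)%:E.

End sigma.

Section rates.
Context (R : realType).

Definition phi_pow (M theta : R) (t : R) : R := M / theta * t `^ theta.

(* big-O along k --> oo for an extended real sequence: in particular u k is
   finite for k large *)
Definition bigO_seq (u : nat -> \bar R) (g : nat -> R) :=
  exists C : R, \forall k \near \oo, (`|u k| <= (C * g k)%:E)%E.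

Definition value_rate (M theta a b : R) (k : nat) : R :=
  if theta < 2^-1 then (k%:R `^ (1 / (1 - 2 * theta)))^-1
  else (1 + a / (b ^+ 2 * M ^+ 2)) `^ (- k%:R).

Definition length_rate (M theta a b : R) (k : nat) : R :=
  if theta < 2^-1 then (k%:R `^ (theta / (1 - 2 * theta)))^-1
  else (1 + a / (b ^+ 2 * M ^+ 2)) `^ (- (k%:R / 2)).

End rates.

(* Main.v *)
Require Import Defs.
From mathcomp Require Import ring lra.

(** Write [r_k = f (x_k) - f xs], [d_k = r_k - r_(k+1)] and
    [lam = b M / sqrt a], so that [(b / sqrt a) phi] is [phi_pow lam theta].

    The Kurdyka-Lojasiewicz inequality at the auxiliary point [xt_k], combined
    with the slope condition and with the fact that [phi'] decreases, gives the
    implicit one-step recursion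

      [r_(k+1) `^ (1 - theta) <= lam * sqrt d_k]                         (R)

    as soon as [xt_k] lies in the ball. Everything else follows from (R) and
    from the sufficient decrease [sqrt a * |x_(k+1) - x_k| <= sqrt d_k].

    - Length. By concavity of [t `^ theta], (R) gives
      [d_(k+1) <= (Phi r_(k+1) - Phi r_(k+2)) * sqrt d_k] with
      [Phi = phi_pow lam theta] (lemma [phi_pow_tangent]). The arithmetic-
      geometric mean inequality turns this into
      [2 sqrt d_(k+1) <= Phi r_(k+1) - Phi r_(k+2) + sqrt d_k], which telescopes
      ([sum_sqrt_decrease]): the length is at most [Phi r_1 + 2 sqrt d_0].

    - Staying in the ball. The value [sg] of [sigma] at [r_0] is the solution of
      [sg `^ (1 - theta) = lam * sqrt (r_0 - sg)], and
      [s |-> Phi s + 2 sqrt (r_0 - s)] increases up to [sg]. Since (R) forces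
      [r_1 <= sg], the previous bound is at most
      [Phi r_0 + 2 sqrt (r_0 - sg)], which is what the hypothesis on the
      starting point controls. An induction on [k] ([trapped]) therefore keeps
      [x_k] and [xt_k] in the ball and establishes (R) for every [k].

    - Rates. Squaring, (R) reads
      [r_(k+1) + c * r_(k+1) `^ (2 - 2 theta) <= r_k] with [c = a / (b M)^2].
      For [theta = 1/2] this is geometric decay with ratio [1 / (1 + c)]; for
      [theta < 1/2] comparison with [E * k `^ (- 1 / (1 - 2 theta))] gives the
      sublinear rate ([sublinear_rate]). The length bound applied from index
      [k] on shows that the tail is of order [r_k `^ theta], because
      [theta <= 1/2] makes [sqrt r_k] of that order too. *)

Set Implicit Arguments.
Unset Strict Implicit.
Unset Printing Implicit Defensive.

Local Open Scope classical_set_scope.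
Local Open Scope ring_scope.

(** * The desingularizing function *)

(** Young's inequality with exponents [1 / (1 - t)] and [1 / t]. *)
Lemma powR_young (R : realType) (t u v : R) :
  0 < t -> t < 1 -> 0 <= u -> 0 <= v ->
  u `^ (1 - t) * v `^ t <= (1 - t) * u + t * v.
Proof.
move=> t0 t1 u0 v0; have s0 : 0 < 1 - t by rewrite subr_gt0.
have := @conjugate_powR R (u `^ (1 - t)) (v `^ t) (1 - t)^-1 t^-1
  (powR_ge0 _ _) (powR_ge0 _ _).
rewrite !invr_gt0 !invrK subrK -!powRrM => /(_ s0 t0 erefl).
by rewrite !divff ?gt_eqF// !powRr1// [u * _]mulrC [v * _]mulrC.
Qed.

Lemma powR_onemM (R : realType) (t u : R) : 0 <= u -> u `^ (1 - t) * u `^ t = u.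
Proof. by move=> u0; rewrite -powRD subrK ?powRr1// oner_eq0. Qed.

Lemma phi_pow_ge0 (R : realType) (M t u : R) :
  0 < M -> 0 < t -> 0 <= phi_pow M t u.
Proof. by move=> M0 t0; rewrite mulr_ge0 ?powR_ge0// divr_ge0// ltW. Qed.

Lemma phi_pow_le (R : realType) (M t u v : R) :
  0 < M -> 0 < t -> 0 <= v -> v <= u -> phi_pow M t v <= phi_pow M t u.
Proof.
move=> M0 t0 v0 vu; apply: ler_wpM2l; first by rewrite divr_ge0// ltW.
by apply: ge0_ler_powR; rewrite ?nnegrE ?(ltW t0) ?(le_trans v0 vu).
Qed.

Lemma derive1_phi_pow (R : realType) (M t u : R) :
  0 < t -> 0 < u -> derive1 (phi_pow M t) u = M * (u `^ (1 - t))^-1.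
Proof.
move=> t0 u0; have hd := is_derive1_powR t u0.
rewrite derive1E /phi_pow.
have -> : 'D_1 (fun v => M / t * v `^ t) u = M / t * (t * u `^ (t - 1)).
  have [_ e] := @is_deriveZ _ _ _ (fun v => v `^ t) (M / t) u 1 _ hd.
  exact: e.
by rewrite -powRN opprB; field; rewrite gt_eqF.
Qed.

(** The tangent inequality for the concave function [Phi = phi_pow lam t]:
    the hypothesis bounds [1 / Phi' u] by [sqrt d], so that
    [u - v <= (Phi u - Phi v) / Phi' u] is at most the right-hand side. The
    multiplied form also covers [u = 0], where [Phi] has no derivative. It is
    used both with [u, v] two consecutive values of the sequence and with [u]
    the value of [sigma]. *)
Lemma phi_pow_tangent (R : realType) (lam t u v d : R) :
  0 < lam -> 0 < t -> t < 1 -> 0 <= v -> v <= u ->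
  u `^ (1 - t) <= lam * Num.sqrt d ->
  u - v <= (phi_pow lam t u - phi_pow lam t v) * Num.sqrt d.
Proof.
move=> lam0 t0 t1 v0 vu ud; have u0 := le_trans v0 vu.
have uvt : 0 <= u `^ t - v `^ t.
  by rewrite subr_ge0; apply: ge0_ler_powR; rewrite ?nnegrE// ltW.
have -> : (phi_pow lam t u - phi_pow lam t v) * Num.sqrt d =
   (lam * Num.sqrt d) * (u `^ t - v `^ t) / t by rewrite /phi_pow; ring.
rewrite ler_pdivlMr//; apply: le_trans (ler_wpM2r uvt ud).
rewrite mulrBr powR_onemM//; have := powR_young t0 t1 u0 v0; lra.
Qed.

(** * Length of a sequence of values *)

Lemma amgm_sqr (R : realFieldType) (E y z : R) :
  0 <= E -> 0 <= y -> 0 <= z -> y ^+ 2 <= E * z -> 2 * y <= E + z.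
Proof.
move=> E0 y0 z0 h.
rewrite -(@ler_pXn2r _ 2) ?nnegrE ?mulr_ge0 ?addr_ge0//.
have := sqr_ge0 (E - z); nra.
Qed.

Lemma sqrt_decrease_step (R : realType) (lam t u v d : R) :
  0 < lam -> 0 < t -> t < 1 -> 0 <= v -> v <= u ->
  u `^ (1 - t) <= lam * Num.sqrt d ->
  2 * Num.sqrt (u - v) <= phi_pow lam t u - phi_pow lam t v + Num.sqrt d.
Proof.
move=> lam0 t0 t1 v0 vu ud; apply: amgm_sqr; rewrite ?sqrtr_ge0//.
  by rewrite subr_ge0 phi_pow_le.
by rewrite sqr_sqrtr ?subr_ge0//; exact: phi_pow_tangent.
Qed.

(** Summing [sqrt_decrease_step] telescopes the terms in [phi_pow]; each step
    also leaves one of its two copies of [sqrt d_(j+1)] to pay for the next one,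
    hence the extra last term on the left, which makes the induction work. *)
Lemma sum_sqrt_decrease (R : realType) (lam t : R) (r : nat -> R) (n : nat) :
  0 < lam -> 0 < t -> t < 1 ->
  (forall j, (j <= n)%N -> 0 <= r j.+1 <= r j) ->
  (forall j, (j < n)%N -> r j.+1 `^ (1 - t) <= lam * Num.sqrt (r j - r j.+1)) ->
  \sum_(i < n.+1) Num.sqrt (r i - r i.+1) + Num.sqrt (r n - r n.+1) <=
  phi_pow lam t (r 1%N) - phi_pow lam t (r n.+1) + 2 * Num.sqrt (r 0%N - r 1%N).
Proof.
move=> lam0 t0 t1; elim: n => [|n ih] rge rec.
  by rewrite big_ord1; lra.
have {ih} := ih (fun j jn => rge j (leqW jn)) (fun j jn => rec j (leqW jn)).
have /andP[v0 vu] := rge n.+1 (leqnn _).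
have := sqrt_decrease_step lam0 t0 t1 v0 vu (rec n (leqnn _)).
rewrite [in X in _ -> _ -> X]big_ord_recr /=; lra.
Qed.

(** The map [s |-> Phi s + 2 sqrt (r0 - s)] is largest at [s = sg] among
    [s <= sg], because its derivative [Phi' s - 1 / sqrt (r0 - s)] is
    nonnegative there. The proof uses the tangent inequality at [sg] instead of
    a derivative, which would be singular at both ends. *)
Lemma phi_pow_sqrt_le (R : realType) (lam t r0 s sg : R) :
  0 < lam -> 0 < t -> t < 1 -> 0 <= s -> s <= sg -> sg <= r0 ->
  sg `^ (1 - t) <= lam * Num.sqrt (r0 - sg) ->
  phi_pow lam t s + 2 * Num.sqrt (r0 - s) <=
  phi_pow lam t sg + 2 * Num.sqrt (r0 - sg).
Proof.
move=> lam0 t0 t1 s0 ssg sgr sgd.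
have E0 := phi_pow_le lam0 t0 s0 ssg.
have h := phi_pow_tangent lam0 t0 t1 s0 ssg sgd.
have y0 := sqrtr_ge0 (r0 - s); have z0 := sqrtr_ge0 (r0 - sg).
have y2 : Num.sqrt (r0 - s) ^+ 2 = r0 - s.
  by rewrite sqr_sqrtr// subr_ge0 (le_trans ssg).
have z2 : Num.sqrt (r0 - sg) ^+ 2 = r0 - sg by rewrite sqr_sqrtr// subr_ge0.
suff : 2 * Num.sqrt (r0 - s) <= phi_pow lam t sg - phi_pow lam t s +
                                2 * Num.sqrt (r0 - sg) by lra.
rewrite -(@ler_pXn2r _ 2) ?nnegrE//; last lra.
rewrite sqrrD !exprMn y2 z2.
have := sqr_ge0 (phi_pow lam t sg - phi_pow lam t s).
by nra.
Qed.

(** The bound [Phi r_1 + 2 sqrt d_0] of [sum_sqrt_decrease] expressed through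
    [r_0] alone. The recursion at index [0] forces [r_1 <= sg] and
    [phi_pow_sqrt_le] applies. For [n = 0] the recursion is not yet known at
    index [0], so [r_1 > sg] is possible, but then the single term
    [sqrt (r_0 - r_1)] is below [sqrt (r_0 - sg)]. This case is what puts the
    first auxiliary point in the ball. *)
Lemma sum_sqrt_decrease_sigma (R : realType) (lam t sg : R) (r : nat -> R)
    (n : nat) :
  0 < lam -> 0 < t -> t < 1 -> sg <= r 0%N ->
  sg `^ (1 - t) <= lam * Num.sqrt (r 0%N - sg) ->
  (forall s, 0 <= s -> s <= r 0%N ->
     s `^ (1 - t) <= lam * Num.sqrt (r 0%N - s) -> s <= sg) ->
  (forall j, (j <= n)%N -> 0 <= r j.+1 <= r j) ->
  (forall j, (j < n)%N -> r j.+1 `^ (1 - t) <= lam * Num.sqrt (r j - r j.+1)) ->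
  \sum_(i < n.+1) Num.sqrt (r i - r i.+1) <=
  phi_pow lam t (r 0%N) + 2 * Num.sqrt (r 0%N - sg).
Proof.
move=> lam0 t0 t1 sgr sgd sgmax rge rec.
have /andP[r1 r10] := rge 0%N (leq0n _).
have p0 u := @phi_pow_ge0 R lam t u lam0 t0.
have [r1sg|sgr1] := leP (r 1%N) sg.
  have := sum_sqrt_decrease lam0 t0 t1 rge rec.
  have := phi_pow_sqrt_le lam0 t0 t1 r1 r1sg sgr sgd.
  have := phi_pow_le lam0 t0 (le_trans r1 r1sg) sgr.
  have := p0 (r n.+1); have := sqrtr_ge0 (r n - r n.+1); lra.
case: n rge rec => [|n] rge rec; last first.
  by have := sgmax _ r1 r10 (rec 0%N isT); rewrite leNgt sgr1.
rewrite big_ord1; have : Num.sqrt (r 0%N - r 1%N) <= Num.sqrt (r 0%N - sg).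
  by rewrite ler_wsqrtr// lerB// ltW.
have := p0 (r 0%N); have := sqrtr_ge0 (r 0%N - sg); lra.
Qed.

(** * The function sigma for a power desingularizing function *)

(** The root [sg] is the largest next value that the recursion allows from
    [r0]: at [sg] it holds with equality. *)
Lemma exists_implicit_step (R : realType) (lam t r0 : R) :
  0 < lam -> 0 < t -> t < 1 -> 0 < r0 ->
  exists2 sg, 0 < sg <= r0 & sg `^ (1 - t) = lam * Num.sqrt (r0 - sg).
Proof.
move=> lam0 t0 t1 r00; have s0 : 0 < 1 - t by rewrite subr_gt0.
(* e is a point where the power is below lam * sqrt (r0 - s); starting the
   intermediate value theorem there avoids the continuity of powers at 0. *)
pose w := lam * Num.sqrt (r0 / 2).
have w0 : 0 < w by rewrite mulr_gt0// sqrtr_gt0 divr_gt0.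
pose e := Num.min (r0 / 2) (w `^ (1 - t)^-1).
have e0 : 0 < e by rewrite lt_min divr_gt0//= powR_gt0.
have er2 : e <= r0 / 2 by rewrite ge_min lexx.
have er : e <= r0 by lra.
have ew : e `^ (1 - t) <= lam * Num.sqrt (r0 - e).
  apply: (@le_trans _ _ w); last first.
    by apply: ler_wpM2l; [exact: ltW|rewrite ler_wsqrtr//; lra].
  have -> : w = (w `^ (1 - t)^-1) `^ (1 - t).
    by rewrite -powRrM mulVf ?gt_eqF// powRr1// ltW.
  apply: ge0_ler_powR; rewrite ?nnegrE ?powR_ge0// ?(ltW s0) ?(ltW e0)//.
  by rewrite ge_min lexx orbT.
pose f s := s `^ (1 - t) - lam * Num.sqrt (r0 - s).
have fc : {within `[e, r0], continuous f}.
  apply: continuous_in_subspaceT => s; rewrite inE/= in_itv/= => /andP[es _].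
  have sgt0 := lt_le_trans e0 es.
  have pc : {for s, continuous (fun u : R => u `^ (1 - t))}.
    apply: differentiable_continuous; apply/derivable1_diffP.
    by apply: derivable_powR; rewrite in_itv/= sgt0.
  apply: cvgB; first exact: pc.
  apply: cvgMl_tmp; apply: (@continuous_comp _ _ _ (fun s => r0 - s) Num.sqrt).
    by apply: cvgB; [exact: cvg_cst|exact: cvg_id].
  exact: sqrt_continuous.
have fe : f e <= 0 by rewrite subr_le0.
have fr : 0 <= f r0 by rewrite /f subrr sqrtr0 mulr0 subr0 powR_ge0.
have /(_ fc) [] := @IVT R f e r0 0 er.
  by rewrite ge_min fe le_max fr orbT.
move=> c; rewrite in_itv/= => /andP[ec cr] /eqP; rewrite subr_eq0 => /eqP fcE.
by exists c => //; rewrite cr (lt_le_trans e0).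
Qed.

Lemma inv_sqr_alpha_of_le (R : realType) (a b M t s d : R) :
  0 < a -> 0 < b -> 0 < M -> 0 < t -> 0 < s -> 0 <= d ->
  ((alpha_of a b (phi_pow M t) s ^+ 2)^-1 <= d%:E)%E =
  (s `^ (1 - t) <= b / Num.sqrt a * M * Num.sqrt d).
Proof.
move=> a0 b0 M0 t0 s0 d0.
rewrite /alpha_of gt_eqF// derive1_phi_pow//.
have l0 : 0 < b / Num.sqrt a * M by rewrite mulr_gt0// divr_gt0// sqrtr_gt0.
have p0 : 0 < s `^ (1 - t) by rewrite powR_gt0.
rewrite mulrA; move: (_ * M) (s `^ _) l0 p0 => l p l0 p0.
rewrite -EFin_expe inver gt_eqF; last by rewrite exprn_gt0// divr_gt0.
rewrite lee_fin -exprVn invfM invrK mulrC.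
rewrite -[d in LHS]sqr_sqrtr// ler_pXn2r ?nnegrE ?sqrtr_ge0//; last first.
  by rewrite divr_ge0// ltW.
by rewrite ler_pdivrMr// mulrC.
Qed.

(** For [r0 > 0] the maximum defining [sigma] is attained at the root given by
    [exists_implicit_step], since the left side of the condition increases with
    [s] and the right side decreases. The point [0], where [alpha_of] is a
    limit, lies below the root, so membership is computed for positive [s]
    only. For [r0 = 0] the set has no point other than [0]. *)
Lemma sigma_alpha_ofP (R : realType) (a b M t r0 : R) :
  0 < a -> 0 < b -> 0 < M -> 0 < t -> t < 1 -> 0 <= r0 ->
  let lam := b / Num.sqrt a * M in
  let sg := sigma (alpha_of a b (phi_pow M t)) r0 in
  [/\ sg <= r0, sg `^ (1 - t) <= lam * Num.sqrt (r0 - sg) &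
      forall s, 0 <= s -> s <= r0 ->
        s `^ (1 - t) <= lam * Num.sqrt (r0 - s) -> s <= sg].
Proof.
move=> a0 b0 M0 t0 t1 r00 lam sg.
have s0 : 0 < 1 - t by rewrite subr_gt0.
have l0 : 0 < lam by rewrite mulr_gt0// divr_gt0// sqrtr_gt0.
move: r00; rewrite le_eqVlt => /predU1P[r00|r00].
  have -> : sg = 0.
    rewrite /sg /sigma /set_max -r00; case: xgetP => // y _ [] [y0 y1 _] _.
    by apply/eqP; rewrite eq_le y0 y1.
  rewrite -r00; split => //.
  by rewrite powR0 ?gt_eqF// mulr_ge0 ?sqrtr_ge0// ltW.
have [c /andP[c0 cr] cE] := exists_implicit_step l0 t0 t1 r00.
have cmax s : 0 <= s -> s <= r0 ->
    s `^ (1 - t) <= lam * Num.sqrt (r0 - s) -> s <= c.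
  move=> sge sr h; rewrite leNgt; apply/negP => cs.
  suff : s `^ (1 - t) <= c `^ (1 - t).
    rewrite leNgt => /negP; apply.
    by apply: gt0_ltr_powR; rewrite ?nnegrE// ltW.
  rewrite cE; apply: (le_trans h); apply: ler_wpM2l; first exact: ltW.
  by apply: ler_wsqrtr; rewrite lerB// ltW.
suff -> : sg = c by split => //; rewrite cE.
rewrite /sg /sigma /set_max; apply: xget_subset1.
  split => /=.
    by split; rewrite ?(ltW c0)// inv_sqr_alpha_of_le// ?subr_ge0// -/lam cE.
  move=> s [sge sr]; have [->|sn0] := eqVneq s 0; first by move=> _; exact: ltW.
  have sp : 0 < s by rewrite lt0r sn0.
  by rewrite inv_sqr_alpha_of_le// ?subr_ge0//; exact: cmax.
move=> y z [Ay My] [Az Mz]; apply/eqP; rewrite eq_le.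
by rewrite My// Mz.
Qed.

(** * The Euclidean norm *)

Lemma edot_ge0 (R : realType) n (u : 'rV[R]_n) : 0 <= edot u u.
Proof. by apply: sumr_ge0 => i _; rewrite -expr2 sqr_ge0. Qed.

Lemma enorm_ge0 (R : realType) n (u : 'rV[R]_n) : 0 <= enorm u.
Proof. exact: sqrtr_ge0. Qed.

Lemma enorm_sqr (R : realType) n (u : 'rV[R]_n) : enorm u ^+ 2 = edot u u.
Proof. by rewrite sqr_sqrtr// edot_ge0. Qed.

Lemma enormN (R : realType) n (u : 'rV[R]_n) : enorm (- u) = enorm u.
Proof.
rewrite /enorm /edot; congr Num.sqrt; apply: eq_bigr => i _.
by rewrite !mxE mulrNN.
Qed.

Lemma enorm0 (R : realType) n : enorm (0 : 'rV[R]_n) = 0.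
Proof. by rewrite /enorm /edot big1 ?sqrtr0// => i _; rewrite mxE mulr0. Qed.

Lemma enorm_eq0 (R : realType) n (u : 'rV[R]_n) : enorm u = 0 -> u = 0.
Proof.
move=> u0; have /eqP : edot u u = 0 by rewrite -enorm_sqr u0 expr0n.
rewrite psumr_eq0 => [/allP h|i _]; last by rewrite -expr2 sqr_ge0.
apply/rowP => i; rewrite mxE; apply/eqP; rewrite -sqrf_eq0 expr2.
exact: h (mem_index_enum i).
Qed.

Lemma edot_lincomb (R : realType) n (s t : R) (u v : 'rV[R]_n) :
  edot (s *: u - t *: v) (s *: u - t *: v) =
  s ^+ 2 * edot u u - 2 * s * t * edot u v + t ^+ 2 * edot v v.
Proof.
rewrite /edot !mulr_sumr -sumrB -big_split/=; apply: eq_bigr => i _.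
by rewrite !mxE; ring.
Qed.

(** Cauchy-Schwarz: for nonzero vectors, expand the square of
    [|v| u - |u| v]. *)
Lemma edot_cauchy_schwarz (R : realType) n (u v : 'rV[R]_n) :
  edot u v <= enorm u * enorm v.
Proof.
have [u0|u0] := eqVneq (enorm u) 0; last have [v0|v0] := eqVneq (enorm v) 0.
- by rewrite u0 mul0r (enorm_eq0 u0) /edot big1// => i _; rewrite mxE mul0r.
- by rewrite v0 mulr0 (enorm_eq0 v0) /edot big1// => i _; rewrite mxE mulr0.
have up : 0 < enorm u by rewrite lt_neqAle eq_sym u0 enorm_ge0.
have vp : 0 < enorm v by rewrite lt_neqAle eq_sym v0 enorm_ge0.
have := edot_ge0 (enorm v *: u - enorm u *: v).
rewrite edot_lincomb -!enorm_sqr.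
have -> : enorm v ^+ 2 * enorm u ^+ 2 - 2 * enorm v * enorm u * edot u v +
  enorm u ^+ 2 * enorm v ^+ 2 =
  (2 * (enorm u * enorm v)) * (enorm u * enorm v - edot u v) by ring.
by rewrite pmulr_rge0 ?subr_ge0// mulr_gt0// mulr_gt0.
Qed.

Lemma enormD (R : realType) n (u v : 'rV[R]_n) :
  enorm (u + v) <= enorm u + enorm v.
Proof.
rewrite -(@ler_pXn2r _ 2) ?nnegrE ?addr_ge0 ?enorm_ge0//.
have := edot_lincomb 1 (-1) u v; rewrite scale1r scaleN1r opprK enorm_sqr => ->.
have := edot_cauchy_schwarz u v; rewrite sqrrD !enorm_sqr; lra.
Qed.

(** * Confinement to the ball *)

Lemma enorm_le_sqrt_decrease (R : realType) n (a r r' : R) (u : 'rV[R]_n) :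
  0 < a -> r' + a * enorm u ^+ 2 <= r ->
  Num.sqrt a * enorm u <= Num.sqrt (r - r').
Proof.
move=> a0 h; have -> : Num.sqrt a * enorm u = Num.sqrt (a * enorm u ^+ 2).
  by rewrite sqrtrM ?ltW// sqrtr_sqr ger0_norm ?enorm_ge0.
by apply: ler_wsqrtr; rewrite lerBrDl.
Qed.

(** The last hypothesis is the conditional form of the recursion: it holds at
    index [k] if every point reachable from [x k] by a step allowed by the
    decrease lies in the ball, which covers [x k.+1] and the auxiliary point
    alike. The distance of such points to [x 0] is at most the length up to
    index [k], and [sum_sqrt_decrease_sigma] bounds this length using the
    recursion at smaller indices only; hence the induction. *)
Lemma trapped (R : realType) n (lam t a delta sg : R) (xs : 'rV[R]_n)
    (x : nat -> 'rV[R]_n) (r : nat -> R) :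
  0 < lam -> 0 < t -> t < 1 -> 0 < a -> 0 <= r 0%N ->
  sg <= r 0%N ->
  sg `^ (1 - t) <= lam * Num.sqrt (r 0%N - sg) ->
  (forall s, 0 <= s -> s <= r 0%N ->
     s `^ (1 - t) <= lam * Num.sqrt (r 0%N - s) -> s <= sg) ->
  phi_pow lam t (r 0%N) + 2 * Num.sqrt (r 0%N - sg) +
    Num.sqrt a * enorm (x 0%N - xs) < Num.sqrt a * delta ->
  (forall k, r k.+1 + a * enorm (x k.+1 - x k) ^+ 2 <= r k) ->
  (forall k, open_eball xs delta (x k) -> 0 <= r k.+1) ->
  (forall k, 0 <= r k.+1 ->
    (forall y, Num.sqrt a * enorm (y - x k) <= Num.sqrt (r k - r k.+1) ->
       open_eball xs delta y) ->
    r k.+1 `^ (1 - t) <= lam * Num.sqrt (r k - r k.+1)) ->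
  forall k, 0 <= r k /\ r k.+1 `^ (1 - t) <= lam * Num.sqrt (r k - r k.+1).
Proof.
move=> lam0 t0 t1 a0 r00 sgr sgd sgmax start desc nneg kl.
have sa0 : 0 < Num.sqrt a by rewrite sqrtr_gt0.
have mono j : r j.+1 <= r j.
  by apply: le_trans (desc j); rewrite lerDl mulr_ge0 ?sqr_ge0// ltW.
suff P k : [/\ forall j, (j <= k)%N -> 0 <= r j,
    forall j, (j < k)%N -> r j.+1 `^ (1 - t) <= lam * Num.sqrt (r j - r j.+1),
    Num.sqrt a * enorm (x k - x 0%N) <=
      \sum_(i < k) Num.sqrt (r i - r i.+1) &
    open_eball xs delta (x k)].
  move=> k; have [r0 rec _ _] := P k.+1.
  by split; [exact: r0 (leqnSn k)|exact: rec].
elim: k => [|k [r0 rec dist ball]].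
  split => [[]//|//||].
    by rewrite subrr big_ord0 enorm0 mulr0.
  rewrite /open_eball /= -(ltr_pM2l sa0); apply: le_lt_trans start.
  by rewrite lerDr addr_ge0 ?phi_pow_ge0// mulr_ge0 ?sqrtr_ge0.
have rk1 := nneg k ball.
have r0' j : (j <= k.+1)%N -> 0 <= r j.
  by rewrite leq_eqVlt => /predU1P[->//|]; rewrite ltnS; exact: r0.
have far y : Num.sqrt a * enorm (y - x k) <= Num.sqrt (r k - r k.+1) ->
    Num.sqrt a * enorm (y - x 0%N) <=
      \sum_(i < k.+1) Num.sqrt (r i - r i.+1).
  move=> yk; rewrite big_ord_recr/=; apply: le_trans (lerD dist yk).
  rewrite -mulrDr ler_pM2l//.
  by have := enormD (y - x k) (x k - x 0%N); rewrite subrKA [X in _ <= X]addrC.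
have inb y : Num.sqrt a * enorm (y - x 0%N) <=
      \sum_(i < k.+1) Num.sqrt (r i - r i.+1) -> open_eball xs delta y.
  move=> yk; rewrite /open_eball /= -(ltr_pM2l sa0).
  apply: le_lt_trans start.
  have rge j : (j <= k)%N -> 0 <= r j.+1 <= r j by move=> jk; rewrite r0' ?mono.
  have tl := sum_sqrt_decrease_sigma lam0 t0 t1 sgr sgd sgmax rge rec.
  apply: le_trans (lerD (le_trans yk tl) (lexx _)).
  rewrite -mulrDr ler_pM2l//.
  by have := enormD (y - x 0%N) (x 0%N - xs); rewrite subrKA.
have st := enorm_le_sqrt_decrease a0 (desc k).
split => // [j||]; [|exact: far|by apply: inb; exact: far].
rewrite ltnS leq_eqVlt => /predU1P[->|]; last exact: rec.
by apply: kl => // y yk; apply: inb; exact: far.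
Qed.

(** * Rates for the values *)

Lemma recursion_sqr (R : realType) (lam t u d : R) :
  0 < lam -> t < 1 -> 0 <= u -> 0 <= d ->
  u `^ (1 - t) <= lam * Num.sqrt d ->
  (lam ^+ 2)^-1 * (u * u `^ (1 - 2 * t)) <= d.
Proof.
move=> lam0 t1 u0 d0; rewrite -(@ler_pXn2r _ 2) ?nnegrE ?powR_ge0//; last first.
  by rewrite mulr_ge0 ?sqrtr_ge0// ltW.
rewrite exprMn sqr_sqrtr// ler_pdivrMl ?exprn_gt0//.
have p0 : 0 < 1 - t + (1 - t) by lra.
rewrite expr2 -powRD ?(gt_eqF p0)// -mulr_powRB1//.
by have -> : 1 - t + (1 - t) - 1 = 1 - 2 * t by ring.
Qed.

(** Convexity of the power [v] on the segment from [1] to [2]. *)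
Lemma powR1D_le (R : realType) (u v : R) :
  0 <= u -> u <= 1 -> 1 <= v -> (1 + u) `^ v <= 1 + u * 2 `^ v.
Proof.
move=> u0 u1 v1.
have := @convex_powR R v v1 (Itv01 u0 u1) 2 1.
rewrite !inE/= !in_itv/= !andbT => /(_ (ler0n _ _) ler01).
rewrite [X in _ <= X -> _]convRE [X in X `^ _ <= _ -> _]convRE/=.
rewrite /unstable.onem powR1 !mulr1.
have -> : u * 2 + (1 - u) = 1 + u by ring.
move=> h; apply: (le_trans h); rewrite [in X in _ <= X]addrC lerD2l.
by rewrite lerBlDr lerDl.
Qed.

(** Comparison with [g k = E * k `^ (- 1 / q)]: as [s |-> s + c s `^ (1 + q)]
    increases, it suffices that [g] satisfies the reverse recursion. Now
    [g k / g (k+1) = (1 + 1 / k) `^ (1 / q) <= 1 + 2 `^ (1 / q) / k], while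
    [1 + c (g (k+1)) `^ q = 1 + c E `^ q / (k + 1)]; since [k + 1 <= 2 k], the
    condition on [E] is enough. *)
Lemma sublinear_rate (R : realType) (q c E : R) (r : nat -> R) :
  0 < q -> q <= 1 -> 0 < c -> 0 < E ->
  2 * 2 `^ q^-1 <= c * E `^ q ->
  (forall k, 0 <= r k) -> r 1%N <= E ->
  (forall k, r k.+1 + c * (r k.+1 * r k.+1 `^ q) <= r k) ->
  forall k, (0 < k)%N -> r k <= E * (k%:R `^ q^-1)^-1.
Proof.
move=> q0 q1 c0 E0 cE r0 r1 rec [//|k] _.
have v1 : 1 <= q^-1 by rewrite invf_ge1.
elim: k => [|k ih]; first by rewrite powR1 invr1 mulr1.
pose g k := E * (k%:R `^ q^-1)^-1; rewrite -/(g _) in ih *.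
rewrite leNgt; apply/negP => gs.
have pk m : 0 < (m.+1%:R : R) `^ q^-1 by rewrite powR_gt0.
have g0 m : 0 < g m.+1 by rewrite mulr_gt0// invr_gt0.
have gq : g k.+2 `^ q = E `^ q / k.+2%:R.
  rewrite powRM ?invr_ge0 ?powR_ge0 ?(ltW E0)//; congr (_ * _).
  by rewrite -powRN -powRrM mulNr mulVf ?gt_eqF// powR_inv1.
have gr : g k.+2 + c * (g k.+2 * g k.+2 `^ q) < g k.+1.
  apply: lt_le_trans ih; apply: lt_le_trans (rec k.+1).
  apply: ltr_leD => //; apply: ler_wpM2l; first exact: ltW.
  have gk0 := ltW (g0 k.+1); apply: ler_pM; rewrite ?powR_ge0 ?(ltW gs)//.
  by apply: ge0_ler_powR; rewrite ?nnegrE ?(ltW gs) ?(ltW q0).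
have ratio : g k.+1 <= g k.+2 * (1 + k.+1%:R^-1 * 2 `^ q^-1).
  have k1 : 0 < (k.+1%:R : R) by [].
  have u1 : (k.+1%:R : R)^-1 <= 1 by rewrite invf_le1// ler1n.
  have := @powR1D_le R k.+1%:R^-1 q^-1 (ltW (etrans (invr_gt0 _) k1)) u1 v1.
  have -> : 1 + (k.+1%:R : R)^-1 = k.+2%:R / k.+1%:R.
    by rewrite -[k.+2%:R]natr1; field; rewrite gt_eqF.
  move=> h; have := ler_wpM2l (ltW (g0 k.+1)) h; apply: le_trans.
  rewrite powRM ?invr_ge0// -[k.+1%:R^-1]powR_inv1// powRAC.
  rewrite powR_inv1 ?powR_ge0// /g le_eqVlt; apply/orP; left; apply/eqP.
  by field; apply/andP; split; rewrite gt_eqF.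
have := lt_le_trans gr ratio; rewrite mulrCA -[X in X + _]mulr1 -mulrDr.
rewrite ltr_pM2l// ltrD2l gq mulrA => h.
have : k.+2%:R^-1 * (c * E `^ q) < k.+1%:R^-1 * 2 `^ q^-1 by rewrite mulrC.
move/(le_lt_trans (ler_wpM2l _ cE)); rewrite mulrA ltr_pM2r ?powR_gt0//.
rewrite invr_ge0 => /(_ (ler0n _ _)).
rewrite mulrC ltr_pdivrMr ?ltr0n// mulrC ltr_pdivlMr ?ltr0n//.
by rewrite -natrM ltr_nat mul2n -addnn !addSn !addnS !ltnS ltnNge leq_addl.
Qed.

(** The second entry of the maximum is the least [E] allowed in
    [sublinear_rate]; the first covers index [1] there, and the geometric
    rate. *)
Definition value_const (R : realType) (M t a b h : R) : R :=
  let c := a / (b ^+ 2 * M ^+ 2) in let q := 1 - 2 * t in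
  Num.max h ((2 * 2 `^ q^-1 / c) `^ q^-1).

Lemma value_const_ge0 (R : realType) (M t a b h : R) :
  0 <= value_const M t a b h.
Proof. by rewrite le_max powR_ge0 orbT. Qed.

Lemma value_rate_ge0 (R : realType) (M t a b : R) k : 0 <= value_rate M t a b k.
Proof. by rewrite /value_rate; case: ifP; rewrite ?invr_ge0 powR_ge0. Qed.

Lemma value_rate_bound (R : realType) (M t a b H : R) (r : nat -> R) :
  0 < M -> 0 < t -> t <= 2^-1 -> 0 < a -> 0 < b ->
  (forall k, 0 <= r k) -> (forall k, r k.+1 <= r k) -> r 0%N <= H ->
  (forall k, r k.+1 `^ (1 - t) <=
     b / Num.sqrt a * M * Num.sqrt (r k - r k.+1)) ->
  forall k, (0 < k)%N -> r k <= value_const M t a b H * value_rate M t a b k.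
Proof.
move=> M0 t0 t2 a0 b0 r0 mono rH rec k k0.
have t1 : t < 1 by lra.
pose c := a / (b ^+ 2 * M ^+ 2).
have c0 : 0 < c by rewrite divr_gt0// mulr_gt0// exprn_gt0.
have l0 : 0 < b / Num.sqrt a * M by rewrite mulr_gt0// divr_gt0// sqrtr_gt0.
have {}rec j : r j.+1 + c * (r j.+1 * r j.+1 `^ (1 - 2 * t)) <= r j.
  have := recursion_sqr l0 t1 (r0 j.+1) _ (rec j).
  rewrite subr_ge0 => /(_ (mono j)).
  rewrite !exprMn exprVn sqr_sqrtr ?(ltW a0)// lerBrDl /c => h.
  apply: le_trans h; rewrite lerD2l.
  by have -> : a / (b ^+ 2 * M ^+ 2) = (b ^+ 2 / a * M ^+ 2)^-1
    by field; rewrite !gt_eqF.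
rewrite /value_rate; case: ltP => tlt.
  have q0 : 0 < 1 - 2 * t by lra.
  have q1 : 1 - 2 * t <= 1 by lra.
  pose A := 2 * 2 `^ (1 - 2 * t)^-1 : R.
  have A0 : 0 < A by rewrite mulr_gt0// powR_gt0.
  have Q0 : 0 < (A / c) `^ (1 - 2 * t)^-1 by rewrite powR_gt0// divr_gt0.
  rewrite div1r; apply: (@sublinear_rate _ (1 - 2 * t) c) => //.
  - by rewrite lt_max Q0 orbT.
  - rewrite -/A mulrC -ler_pdivrMr//.
    have -> : A / c = ((A / c) `^ (1 - 2 * t)^-1) `^ (1 - 2 * t).
      by rewrite -powRrM mulVf ?gt_eqF// powRr1// ltW// divr_gt0.
    apply: ge0_ler_powR; rewrite ?nnegrE ?powR_ge0 ?value_const_ge0 ?(ltW q0)//.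
    by rewrite le_max lexx orbT.
  - by apply: le_trans (mono _) _; rewrite le_max rH.
have q0 : 1 - 2 * t = 0 by lra.
have cp : 0 < 1 + c by rewrite addr_gt0.
rewrite powR_invn ?(ltW cp)// -/c.
have HV : H <= value_const M t a b H by rewrite le_max lexx.
apply: (@le_trans _ _ (H * (1 + c) ^- k)); last first.
  by apply: ler_wpM2r => //; rewrite invr_ge0 exprn_ge0// ltW.
elim: k {k0} => [|k ih]; first by rewrite expr0 invr1 mulr1.
have := rec k; rewrite q0 powRr0 mulr1 => h.
rewrite exprS invfM mulrCA ler_pdivlMl//.
by apply: le_trans ih; rewrite mulrDl mul1r.
Qed.

(** * Rates for the lengths *)

(** From [sum_sqrt_decrease_tail] and [sqrt u <= h `^ (1/2 - t) * u `^ t] for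
    [u <= h], the tail is at most [K * r_k `^ t / sqrt a], where [K] is the
    numerator below. *)
Definition length_const (R : realType) (M t a b h : R) : R :=
  (b / Num.sqrt a * M / t + 2 * h `^ (2^-1 - t)) / Num.sqrt a *
  value_const M t a b h `^ t.

Lemma length_const_ge0 (R : realType) (M t a b h : R) :
  0 < M -> 0 < t -> 0 < a -> 0 < b -> 0 <= length_const M t a b h.
Proof.
move=> M0 t0 a0 b0; have sa0 : 0 < Num.sqrt a by rewrite sqrtr_gt0.
apply: mulr_ge0; last exact: powR_ge0.
apply: divr_ge0; last exact: ltW.
apply: addr_ge0; last by rewrite mulr_ge0// powR_ge0.
by rewrite ltW// divr_gt0// mulr_gt0// divr_gt0.
Qed.

Lemma length_rate_ge0 (R : realType) (M t a b : R) k :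
  0 <= length_rate M t a b k.
Proof. by rewrite /length_rate; case: ifP; rewrite ?invr_ge0 powR_ge0. Qed.

Lemma value_rate_powR (R : realType) (M t a b : R) k :
  t <= 2^-1 -> value_rate M t a b k `^ t = length_rate M t a b k.
Proof.
rewrite /value_rate /length_rate; case: ltP => [tlt _|tge tle].
  by rewrite -!powRN -powRrM mulNr mulrAC mul1r.
have -> : t = 2^-1 by apply/eqP; rewrite eq_le tle tge.
by rewrite -powRrM mulNr.
Qed.

Lemma sum_sqrt_decrease_tail (R : realType) (lam t : R) (r : nat -> R) k n :
  0 < lam -> 0 < t -> t < 1 ->
  (forall k, 0 <= r k) -> (forall k, r k.+1 <= r k) ->
  (forall k, r k.+1 `^ (1 - t) <= lam * Num.sqrt (r k - r k.+1)) ->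
  \sum_(k <= i < n) Num.sqrt (r i - r i.+1) <=
  phi_pow lam t (r k) + 2 * Num.sqrt (r k).
Proof.
move=> lam0 t0 t1 r0 mono rec.
have p0 u := @phi_pow_ge0 R lam t u lam0 t0.
have [nk|kn] := leqP n k.
  by rewrite big_geq// addr_ge0// mulr_ge0// sqrtr_ge0.
rewrite -(subnK (ltnW kn)) -{1}[k]add0n big_addn addnK.
have : (0 < n - k)%N by rewrite subn_gt0.
case: (n - k)%N => // m _; rewrite big_mkord.
pose s i := r (i + k)%N.
have := @sum_sqrt_decrease R lam t s m lam0 t0 t1 _ _.
have sge j : (j <= m)%N -> 0 <= s j.+1 <= s j by rewrite /s r0 mono.
move=> /(_ sge (fun j _ => rec (j + k)%N)).
have := p0 (s m.+1); have := sqrtr_ge0 (s m - s m.+1).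
have := phi_pow_le lam0 t0 (r0 k.+1) (mono k).
have : Num.sqrt (r k - r k.+1) <= Num.sqrt (r k).
  by apply: ler_wsqrtr; rewrite lerBlDr lerDl.
rewrite /s /= add0n add1n.
move: (\sum_(i < _) _) => S; lra.
Qed.

(** Here [d] is the sequence of step lengths. The bound holds for partial sums
    by [sum_sqrt_decrease_tail], and [r k `^ t] inherits its rate from
    [value_rate_bound]. *)
Lemma length_rate_bound (R : realType) (M t a b H : R) (r d : nat -> R) :
  0 < M -> 0 < t -> t <= 2^-1 -> 0 < a -> 0 < b ->
  (forall k, 0 <= r k) -> (forall k, r k.+1 <= r k) -> r 0%N <= H ->
  (forall k, r k.+1 `^ (1 - t) <=
     b / Num.sqrt a * M * Num.sqrt (r k - r k.+1)) ->
  (forall k, 0 <= d k) ->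
  (forall k, Num.sqrt a * d k <= Num.sqrt (r k - r k.+1)) ->
  forall k, (0 < k)%N ->
  (\sum_(k <= i <oo) (d i)%:E <=
    (length_const M t a b H * length_rate M t a b k)%:E)%E.
Proof.
move=> M0 t0 t2 a0 b0 r0 mono rH rec d0 dr k k0.
have t1 : t < 1 by lra.
have sa0 : 0 < Num.sqrt a by rewrite sqrtr_gt0.
have l0 : 0 < b / Num.sqrt a * M by rewrite mulr_gt0// divr_gt0.
apply: lime_le; first by apply: is_cvg_nneseries => i _ _; rewrite lee_fin.
apply: nearW => n; rewrite sumEFin lee_fin.
have rkH : r k <= H.
  by elim: {k0} k => // k; exact: le_trans (mono k).
rewrite -(ler_pM2l sa0) mulr_sumr.
apply: (le_trans (ler_sum _ (fun i _ => dr i))).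
apply: (le_trans (sum_sqrt_decrease_tail k n l0 t0 t1 r0 mono rec)).
have rt : r k `^ t <= value_const M t a b H `^ t * length_rate M t a b k.
  rewrite -value_rate_powR// -powRM ?value_const_ge0 ?value_rate_ge0//.
  apply: ge0_ler_powR; rewrite ?nnegrE ?(ltW t0) ?r0//.
    by rewrite mulr_ge0 ?value_const_ge0 ?value_rate_ge0.
  exact: value_rate_bound.
have rs : Num.sqrt (r k) <= H `^ (2^-1 - t) * r k `^ t.
  rewrite -powR12_sqrt//.
  have -> : r k `^ 2^-1 = r k `^ (2^-1 - t) * r k `^ t.
    by rewrite -powRD subrK// invr_eq0 pnatr_eq0.
  apply: ler_wpM2r; first exact: powR_ge0.
  by apply: ge0_ler_powR; rewrite ?nnegrE ?subr_ge0// (le_trans (r0 k)).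
rewrite /length_const.
have -> : forall x y l : R, Num.sqrt a * (x / Num.sqrt a * y * l) = x * (y * l).
  by move=> x y l; field; rewrite gt_eqF.
have h0 : 0 <= H `^ (2^-1 - t) by exact: powR_ge0.
apply: (@le_trans _ _
   ((b / Num.sqrt a * M / t + 2 * H `^ (2^-1 - t)) * r k `^ t)).
  by rewrite /phi_pow [leRHS]mulrDl lerD2l -mulrA ler_wpM2l.
apply: ler_wpM2l => //; apply: addr_ge0; last exact: mulr_ge0.
by rewrite ltW// divr_gt0.
Qed.

(** * Convergence rates under the Kurdyka-Lojasiewicz inequality *)

Lemma edist_set_ge0 (R : realType) n (A : set 'rV[R]_n) z :
  (0 <= edist_set A z)%E.
Proof.
by apply: le_ereal_inf_tmp => _ [y _ <-]; rewrite lee_fin enorm_ge0.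
Qed.

(** The recursion at one index, with [D] the distance from [0] to the
    subdifferential at the auxiliary point and [u] the gap there: the slope
    condition bounds [D] by [(b / sqrt a) sqrt d], which in particular excludes
    [D = +oo]. *)
Lemma kl_slope (R : realType) (a b M t u d : R) (D : \bar R) :
  0 < a -> 0 < b -> 0 < M -> 0 < t -> 0 < u -> 0 <= d -> (0 <= D)%E ->
  (1 <= (derive1 (phi_pow M t) u)%:E * D)%E ->
  ((a / b ^+ 2)%:E * D ^+ 2 <= d%:E)%E ->
  u `^ (1 - t) <= b / Num.sqrt a * M * Num.sqrt d.
Proof.
move=> a0 b0 M0 t0 u0 d0; rewrite derive1_phi_pow//.
have ab0 : 0 < a / b ^+ 2 by rewrite divr_gt0// exprn_gt0.
have sa0 : 0 < Num.sqrt a by rewrite sqrtr_gt0.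
case: D => [e| |//]; last by move=> _ _; rewrite expe2 mulyy gt0_muley.
rewrite lee_fin -EFin_expe -!EFinM !lee_fin => e0.
rewrite mulrAC ler_pdivlMr ?powR_gt0// mul1r => ue ed.
apply: (le_trans ue).
rewrite [_ / _ * M]mulrC -mulrA ler_pM2l// mulrAC ler_pdivlMr//.
rewrite -(@ler_pXn2r _ 2) ?nnegrE ?mulr_ge0 ?sqrtr_ge0 ?(ltW b0)//.
rewrite !exprMn !sqr_sqrtr ?(ltW a0)// [_ * a]mulrC.
by move: ed; rewrite mulrAC ler_pdivrMr ?exprn_gt0// [d * _]mulrC.
Qed.

Theorem corollary5p1 (R : realType) :
  exists C : R -> R -> R -> R -> R -> R,
  forall (M theta a b : R) (n : nat) (f : 'rV[R]_n -> \bar R)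
    (xs : 'rV[R]_n) (delta : R) (eta : \bar R) (x : nat -> 'rV[R]_n),
  let phi := phi_pow M theta in
  let r0 := fine (f (x 0%N) - f xs)%E in
  let gap := fun k : nat => (f (x k) - f xs)%E in
  let len := fun k : nat => (\sum_(k <= i <oo) (enorm (x i - x i.+1))%:E)%E in
  0 < M -> 0 < theta -> theta <= 2^-1 -> 0 < a -> 0 < b ->
  proper_fun f -> lower_semicontinuous f ->
  KL_inequality f xs delta eta phi ->
  (forall k, f (x k.+1) + (a * enorm (x k.+1 - x k) ^+ 2)%:E <= f (x k))%E ->
  (forall k, exists xt : 'rV[R]_n,
    [/\ limiting_subdiff f xt !=set0,
        (((a / b ^+ 2)%R)%:E * (edist_set (limiting_subdiff f xt) 0%R) ^+ 2
           <= f (x k) - f (x k.+1))%E,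
        (f (x k.+1) <= f xt)%E &
        (f xt <= f (x k) - (a * enorm (xt - x k) ^+ 2)%:E)%E]) ->
  (f xs <= f (x 0%N))%E -> (f (x 0%N) < eta)%E ->
  (forall k, open_eball xs delta (x k) -> (f xs <= f (x k.+1))%E) ->
  b / a * phi r0 + 2 * Num.sqrt ((r0 - sigma (alpha_of a b phi) r0) / a)
    + enorm (x 0%N - xs) < delta ->
  [/\ bigO_seq gap (value_rate M theta a b),
      bigO_seq len (length_rate M theta a b) &
      forall h : R, (eta - f xs)%E = h%:E ->
        forall k : nat, (0 < k)%N ->
          (`|gap k| <= (C M theta a b h * value_rate M theta a b k)%:E)%E /\
          (`|len k| <= (C M theta a b h * length_rate M theta a b k)%:E)%E].
Proof.
exists (fun M t a b h => value_const M t a b h + length_const M t a b h).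
move=> M t a b n f xs delta eta x phi r0 gap len M0 t0 t2 a0 b0 [fNy _] _.
move=> [fxs _ _ KL] desc approx f0 f0eta nneg start.
have t1 : t < 1 by lra.
have sa0 : 0 < Num.sqrt a by rewrite sqrtr_gt0.
have lam0 : 0 < b / Num.sqrt a * M by rewrite mulr_gt0// divr_gt0.
(* All values of f along the sequence are finite: reduce to real numbers. *)
have [fs fsE] : exists fs : R, f xs = fs%:E.
  by exists (fine (f xs)); rewrite fineK.
have fin_le y z : (f z < +oo)%E -> (f y <= f z)%E ->
    f y = (fs + fine (f y - f xs))%:E.
  move=> zoo yz; have : f y \is a fin_num.
    by rewrite fin_numE fNy lt_eqF// (le_lt_trans yz).
  by move/fineK => <-; rewrite fsE -EFinB/= addrC subrK.
pose r k := fine (f (x k) - f xs)%E.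
have le_prev k : (f (x k.+1) <= f (x k))%E.
  apply: le_trans (desc k); rewrite leeDl// lee_fin.
  by rewrite mulr_ge0 ?sqr_ge0// ltW.
have le_start k : (f (x k) <= f (x 0%N))%E.
  by elim: k => // k; apply: le_trans.
have foo : (f (x 0%N) < +oo)%E := lt_le_trans f0eta (leey _).
have fE k : f (x k) = (fs + r k)%:E := fin_le _ _ foo (le_start k).
have gapE k : gap k = (r k)%:E by rewrite /gap fE fsE -EFinB addrC addKr.
have rdesc k : r k.+1 + a * enorm (x k.+1 - x k) ^+ 2 <= r k.
  by have := desc k; rewrite !fE -EFinD lee_fin -addrA lerD2l.
have mono k : r k.+1 <= r k.
  by apply: le_trans (rdesc k); rewrite lerDl mulr_ge0 ?sqr_ge0// ltW.
have r00 : 0 <= r 0%N by move: f0; rewrite fE fsE lee_fin lerDl.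
have [sgr sgd sgmax] := sigma_alpha_ofP a0 b0 M0 t0 t1 r00.
have main k : 0 <= r k /\
    r k.+1 `^ (1 - t) <= b / Num.sqrt a * M * Num.sqrt (r k - r k.+1).
  move: k.
  apply: (@trapped _ _ _ _ _ delta _ xs _ _ lam0 t0 t1 a0 r00 sgr sgd sgmax)
    => //.
  - rewrite -(ltr_pM2l sa0) in start; apply: le_lt_trans start.
    rewrite !mulrDr lerD2r; apply: lerD.
      rewrite /phi /phi_pow mulrA -{3}(sqr_sqrtr (ltW a0)).
      rewrite le_eqVlt; apply/orP; left; apply/eqP.
      by field; rewrite !gt_eqF.
    rewrite mulrCA ler_pM2l// sqrtrM ?subr_ge0// sqrtrV ?(ltW a0)//.
    by rewrite mulrCA divff ?gt_eqF// mulr1.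
  - by move=> k /nneg; rewrite fE fsE lee_fin lerDl.
  (* The Kurdyka-Lojasiewicz inequality holds strictly above the level f xs;
     the recursion is trivial when the next value is at that level. *)
  - move=> k; rewrite le_eqVlt => /predU1P[<- _|rk1 ball].
      rewrite powR0 ?gt_eqF ?subr_gt0//.
      by rewrite mulr_ge0 ?sqrtr_ge0// ltW.
    have [xt [_ slope low up]] := approx k.
    have xtk : (f xt <= f (x k))%E.
      apply: (le_trans up); rewrite fE -EFinB lee_fin lerBlDr lerDl.
      by rewrite mulr_ge0 ?sqr_ge0// ltW.
    have xt0 := le_trans xtk (le_start k).
    have := fin_le _ _ foo xt0; move: (fine _) => rt xtE.
    rewrite xtE !fE -?EFinB !lee_fin ?lerD2l in low up slope.
    have rt0 : 0 < rt := lt_le_trans rk1 low.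
    apply: (@le_trans _ _ (rt `^ (1 - t))).
      apply: ge0_ler_powR;
        by rewrite ?nnegrE ?subr_ge0 ?(ltW t1) ?(ltW rk1) ?(ltW rt0).
    apply: (kl_slope a0 b0 M0 t0 rt0 _ (edist_set_ge0 _ 0)); last first.
    + by apply: (le_trans slope); rewrite lee_fin opprD addrACA subrr add0r.
    + have := KL xt; rewrite xtE fsE -EFinB [fs + rt - fs]addrC addKr/=; apply.
      * apply: ball.
        apply: (@le_trans _ _ (Num.sqrt (r k - rt))).
          apply: enorm_le_sqrt_decrease => //.
          by move: up; rewrite -addrA lerD2l lerBrDr.
        by apply: ler_wsqrtr; rewrite lerD2l lerN2.
      * by rewrite lte_fin ltrDl.
      * by rewrite -xtE (le_lt_trans xt0).
    + by rewrite subr_ge0.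
have rpos k : 0 <= r k by have [] := main k.
have rrec k := (main k).2.
have lenE k : len k = (\sum_(k <= i <oo) (enorm (x i.+1 - x i))%:E)%E.
  by apply: eq_eseriesr => i _; rewrite -opprB enormN.
have len0 k : (0 <= len k)%E.
  by rewrite nneseries_ge0// => i _ _; rewrite lee_fin enorm_ge0.
have bounds H k : r 0%N <= H -> (0 < k)%N ->
    (`|gap k| <= (value_const M t a b H * value_rate M t a b k)%:E)%E /\
    (`|len k| <= (length_const M t a b H * length_rate M t a b k)%:E)%E.
  move=> rH k0; split.
    by rewrite gapE lee_fin ger0_norm//; exact: value_rate_bound.
  rewrite gee0_abs// lenE; apply: (@length_rate_bound _ _ _ _ _ _ r) => //.
    by move=> i; exact: enorm_ge0.
  by move=> i; apply: enorm_le_sqrt_decrease.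
(* The starting gap can replace eta - f xs in the constants, which gives the
   asymptotic bounds also when eta is infinite. *)
split.
- exists (value_const M t a b (r 0%N)); exists 1%N => // k k0.
  by have [] := bounds _ k (lexx _) k0.
- exists (length_const M t a b (r 0%N)); exists 1%N => // k k0.
  by have [] := bounds _ k (lexx _) k0.
- move=> h hE k k0; have rh : r 0%N <= h.
    apply: ltW; rewrite -lte_fin -hE -gapE.
    by rewrite /gap lte_leB.
  have [g l] := bounds h k rh k0; split.
  + apply: (le_trans g); rewrite lee_fin ler_wpM2r ?value_rate_ge0//.
    by rewrite lerDl length_const_ge0.
  + apply: (le_trans l); rewrite lee_fin ler_wpM2r ?length_rate_ge0//.
    by rewrite lerDr value_const_ge0.
Qed.
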